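(* Let $f:[0,\infty)\to\mathbb{R}$ belong to $SX((h-s)_2,I)$ with $I=[0,\infty)$, and let $g:[0,\infty)\to[0,\infty)$ be a linear function. Then the composition $f\circ g$ is $(h-s)_2$-convex on $I$.
   Context: Let $J\subseteq\mathbb{R}$ with $[0,1]\subseteq J$, let $h:J\to\mathbb{R}$ be a nonnegative function with $h\not\equiv 0$, and let $s\in(0,1]$. Write $h^s(t)=(h(t))^s$, and let $I=[0,\infty)$. A function $f:[0,\infty)\to\mathbb{R}$ is $(h-s)_2$-convex on $I$ (in the second sense), written $f\in SX((h-s)_2,I)$, if $f$ is nonnegative and for all $u,v\in I$ and $t\in[0,1]$, $$f(tu+(1-t)v)\le h^s(t)f(u)+h^s(1-t)f(v).$$ *)

(* Defs.v *)
From mathcomp Require Import all_boot all_order all_algebra.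
From mathcomp Require Import all_classical all_reals all_analysis.
Set Implicit Arguments.
Unset Strict Implicit.
Unset Printing Implicit Defensive.
Import Order.TTheory GRing.Theory Num.Theory.
Local Open Scope classical_set_scope.
Local Open Scope ring_scope.

(* Functions on a subset of the line are represented by total functions
   [R -> R], of which only the values on that subset are ever constrained. *)

(* [SX2 h s I f] : f belongs to SX((h-s)_2, I).  For s > 0, [0 `^ s = 0], so
   [powR] is the usual power of a nonnegative real. *)
Definition SX2 (R : realType) (h : R -> R) (s : R) (I : set R) (f : R -> R)
    : Prop :=
  (forall x, I x -> 0 <= f x) /\
  (forall u v t, I u -> I v -> `[0, 1]%classic t ->
     f (t * u + (1 - t) * v) <= h t `^ s * f u + h (1 - t) `^ s * f v).

(* [0, +oo[ is only a convex cone, so linearity is compatibility with the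
   linear combinations that stay in it: those with nonnegative scalars. *)
Definition linear_on_nonneg (R : realType) (g : R -> R) : Prop :=
  forall a b u v : R, 0 <= a -> 0 <= b -> 0 <= u -> 0 <= v ->
    g (a * u + b * v) = a * g u + b * g v.

(* Main.v *)
Require Import Defs.
From mathcomp Require Import all_boot all_order all_algebra.
From mathcomp Require Import all_classical all_reals all_analysis.
Import Order.TTheory GRing.Theory Num.Theory.
Local Open Scope classical_set_scope.
Local Open Scope ring_scope.

Theorem theorem2p3 (R : realType) (J : set R) (h : R -> R) (s : R)
    (f g : R -> R)
    (J01 : `[0, 1]%classic `<=` J)
    (h_ge0 : forall t, J t -> 0 <= h t)
    (h_neq0 : exists2 t, J t & h t <> 0)
    (s01 : 0 < s <= 1)
    (fSX : SX2 h s `[0, +oo[%classic f)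
    (g_ge0 : forall x, 0 <= x -> 0 <= g x)
    (g_lin : linear_on_nonneg g) :
  SX2 h s `[0, +oo[%classic (f \o g).
Proof.
case: fSX => f_ge0 f_conv.
have gI x : `[0, +oo[%classic x -> `[0, +oo[%classic (g x).
  by rewrite /= !in_itv /= !andbT; exact: g_ge0.
split=> [x /gI/f_ge0 //|u v t Iu Iv t01 /=].
(* A convex combination has nonnegative weights, so g carries it to the same
   combination of g u and g v, where the inequality for f applies. *)
have -> : g (t * u + (1 - t) * v) = t * g u + (1 - t) * g v.
  move: Iu Iv t01; rewrite /= !in_itv /= !andbT => u0 v0 /andP[t0 t1].
  by apply: g_lin; rewrite ?subr_ge0.
by apply: f_conv => //; exact: gI.
Qed.
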